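(* Let $X$ be a Hilbert space, let $K$ be a compact subset of $X$, and let $f:K\to\mathbb{R}$ and $G:K\to X$ be two continuous functions. Then there exists a convex function $F\in C^1(X)$ such that $F(x)=f(x)$ and $\nabla F(x)=G(x)$ for all $x\in K$ if and only if both of the following conditions hold: (i) $f(x)\geq f(y)+\langle G(y),x-y\rangle$ for all $x,y\in K$; and (ii) for all $x,y\in K$, if $f(x)=f(y)+\langle G(y),x-y\rangle$ then $G(x)=G(y)$. Furthermore, whenever (i) and (ii) are satisfied, the function $F$ (convex, of class $C^1(X)$, with $F=f$ and $\nabla F=G$ on $K$) can be taken to be Lipschitz with $\mathrm{Lip}(F)\leq 5\max_{z\in K}|G(z)|$.
   Context: Hilbert spaces are real, with inner product $\langle\cdot,\cdot\rangle$ and norm $|\cdot|$. $C^1(X)$ is the class of (Fréchet) differentiable functions $F:X\to\mathbb{R}$ whose gradient $\nabla F:X\to X$ is continuous. $\mathrm{Lip}(F)$ denotes the (best) Lipschitz constant of $F$ on $X$. The set $K$ is understood to be nonempty. *)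

(* Defs.v *)
From HB Require Import structures.
From mathcomp Require Import all_boot all_order all_algebra.
From mathcomp Require Import all_classical all_reals all_analysis.
Set Implicit Arguments.
Unset Strict Implicit.
Unset Printing Implicit Defensive.
Import Order.TTheory GRing.Theory Num.Theory.
Import numFieldNormedType.Exports.
Local Open Scope classical_set_scope.
Local Open Scope ring_scope.

(* [{dot X for idfun}] is symmetric, bilinear and positive definite; the given
   norm, which carries topology and completeness, is the one it induces. *)
HB.mixin Record isHilbert (R : realType) X & CompleteNormedModule R X := {
  inner : {dot X for (@idfun R)} ;
  inner_norm : forall x : X, inner x x = `|x| ^+ 2
}.

#[short(type="hilbertType")]
HB.structure Definition Hilbert (R : realType) :=
  { X of isHilbert R X & CompleteNormedModule R X }.

Section Gradient.
Context {R : realType} {X : hilbertType R}.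
Implicit Types (F : X -> R) (K : set X).

(* The vector representing the Fréchet differential at x; it exists, by Riesz,
   and is unique whenever F is differentiable at x. *)
Definition gradient F (x : X) : X :=
  xget 0 [set g : X | forall h : X, 'd F x h = inner g h].

Definition C1 F : Prop :=
  (forall x : X, differentiable F x) /\ continuous (gradient F).

(* The least Lipschitz constant.  Nonnegativity only matters when X = 0, where
   every k satisfies k.-lipschitz F.  If F is not Lipschitz, the value is the
   default 0, hence [lipschitz F] has to be required separately. *)
Definition Lip F : R := inf [set k : R | 0 <= k /\ k.-lipschitz F].

Definition convex_C1_extension K (f : X -> R) (G : X -> X) F : Prop :=
  [/\ convex_function setT F, C1 F,
      forall x, K x -> F x = f x
    & forall x, K x -> gradient F x = G x].

End Gradient.

(* Main.v *)
Require Import Defs.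
From HB Require Import structures.
From mathcomp Require Import all_boot all_order all_algebra.
From mathcomp Require Import all_classical all_reals all_analysis.
From mathcomp Require Import ring lra.
Set Implicit Arguments.
Unset Strict Implicit.
Unset Printing Implicit Defensive.
Import Order.TTheory GRing.Theory Num.Theory.
Import numFieldNormedType.Exports.
Local Open Scope classical_set_scope.
Local Open Scope ring_scope.

(** Necessity is the gradient inequality of a convex function. It gives (i)
directly. If moreover f x lies on the tangent at y, then that tangent supports
F at x too, and a differentiable function has only one supporting affine
function at x, so that G x = G y.

For sufficiency write T_y for the prescribed tangent at y, the affine map
x |-> f y + inner (G y) (x - y), and let M be the largest |G z|. The extension
is squeezed between the tangents and an upper function that touches them on K.

- By (i) and (ii), the gap f y - T_z y is positive as soon as G y <> G z; by
  compactness it is bounded below when |G y - G z| >= eta. Hence for every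
  eta > 0 there is a c with T_z x <= T_y x + eta |x - y| + c |x - y|^2, uniformly
  in y, z in K and x in X ([tangent_spread_small]). With eta = 2 M, c = 0 works.
- Let [profile] t be the infimum of a + b t^2 over all a, b >= 0 for which
  a + b |x - y|^2 absorbs the difference of any two tangents. It is a concave
  function of t^2, which replaces every explicit choice of a modulus of
  continuity: it is o(t) at 0, its slope is at most 4 M because it is at most
  2 M t ([profile_lipschitz]), and the second differences of profile |z| are
  o(|h|) uniformly in z ([profile_smooth]).
- The infimum over y in K of T_y x + profile |x - y| lies above all tangents,
  equals f on K, is (M + 4 M)-Lipschitz and inherits the bound on second
  differences. Its convex envelope F keeps these properties: the tangents are
  convex minorants, and so are the translates and averages of F that express
  the Lipschitz bound and the bound on second differences.
- A convex Lipschitz function whose second differences are uniformly o(|h|) is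
  of class C^1 ([convex_smooth_C1]). The gradient exists as a vector by the
  Riesz representation theorem ([riesz]), and equals G y at y in K because T_y
  supports F there. *)

(** * Inner products and the Riesz representation theorem *)

Section InnerProduct.
Context {R : realType} {X : hilbertType R}.
Implicit Types (x y z : X) (c : R).

Lemma innerC x y : inner x y = inner y x.
Proof. by rewrite (hermC inner) expr0 mul1r. Qed.

Lemma innerDr z x y : inner z (x + y) = inner z x + inner z y.
Proof. exact: linearDr. Qed.

Lemma innerDl z x y : inner (x + y) z = inner x z + inner y z.
Proof. by rewrite innerC innerDr !(innerC z). Qed.

Lemma innerZr z c x : inner z (c *: x) = c * inner z x.
Proof. by rewrite linearZr_LR. Qed.

Lemma innerNr z x : inner z (- x) = - inner z x.
Proof. exact: linearNr. Qed.

Lemma innerNl z x : inner (- x) z = - inner x z.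
Proof. by rewrite innerC innerNr innerC. Qed.

Lemma innerBr z x y : inner z (x - y) = inner z x - inner z y.
Proof. by rewrite innerDr innerNr. Qed.

Lemma innerBl z x y : inner (x - y) z = inner x z - inner y z.
Proof. by rewrite innerDl innerNl. Qed.

Lemma sqr_normD x y : `|x + y| ^+ 2 = `|x| ^+ 2 + 2 * inner x y + `|y| ^+ 2.
Proof.
by rewrite -!inner_norm !innerDl !innerDr (innerC y x); ring.
Qed.

Lemma sqr_normB x y : `|x - y| ^+ 2 = `|x| ^+ 2 - 2 * inner x y + `|y| ^+ 2.
Proof. by rewrite sqr_normD normrN innerNr mulrN. Qed.

Lemma inner_polarization x y :
  inner x y = (`|x + y| ^+ 2 - `|x| ^+ 2 - `|y| ^+ 2) / 2.
Proof. by rewrite sqr_normD; lra. Qed.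

Lemma cvg_inner (T : Type) (D : set_system T) {FD : Filter D} (u v : T -> X) x y :
  u @ D --> x -> v @ D --> y -> (inner (u t) (v t)) @[t --> D] --> inner x y.
Proof.
move=> ux vy; rewrite inner_polarization.
under eq_fun do rewrite inner_polarization.
have sq (w : T -> X) l : w @ D --> l -> (`|w t| ^+ 2 @[t --> D]) --> `|l| ^+ 2.
  move=> wl; rewrite expr2; under eq_fun do rewrite expr2.
  by apply: cvgM; exact: cvg_norm.
apply: cvgM; last exact: cvg_cst.
by apply: cvgB; [apply: cvgB|]; apply: sq => //; exact: cvgD.
Qed.

Lemma inner_le x y : inner x y <= `|x| * `|y|.
Proof.
have : `|x + y| ^+ 2 <= (`|x| + `|y|) ^+ 2.
  by rewrite ler_pXn2r ?nnegrE ?addr_ge0// ler_normD.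
rewrite sqr_normD; lra.
Qed.

Lemma normr_inner_le x y : `|inner x y| <= `|x| * `|y|.
Proof.
rewrite ler_norml inner_le andbT lerNl -innerNr.
by apply: le_trans (inner_le _ _) _; rewrite normrN.
Qed.

(** In the direction of [x] itself the Cauchy-Schwarz inequality is an
equality, so that testing against vectors of one fixed length is enough. *)
Lemma norm_le_inner x r b : 0 < r ->
  (forall h : X, `|h| = r -> inner x h <= b * r) -> 0 <= b -> `|x| <= b.
Proof.
move=> r0 H b0; have [->|x0] := eqVneq x 0; first by rewrite normr0.
have nx : 0 < `|x| by rewrite normr_gt0.
have := H ((r / `|x|) *: x); rewrite innerZr inner_norm normrZ ger0_norm; last first.
  by rewrite divr_ge0// ltW.
have -> : r / `|x| * `|x| ^+ 2 = `|x| * r by field; rewrite gt_eqF.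
by rewrite ler_pM2r//; apply; rewrite divfK ?gt_eqF.
Qed.

Lemma inner_inj x y : (forall h, inner x h = inner y h) -> x = y.
Proof.
move=> H; apply/subr0_eq/normr0_eq0/eqP; rewrite -sqrf_eq0 -inner_norm.
by rewrite innerBl H subrr.
Qed.

(** The representing vector is the minimiser of the quadratic functional
[J u = |u|^2 / 2 - L u]: by the parallelogram identity a minimising sequence
is Cauchy, and the first-order condition at its limit is [L = inner g]. *)
Lemma riesz (L : X -> R) (k : R) :
  (forall x y, L (x + y) = L x + L y) -> (forall c x, L (c *: x) = c * L x) ->
  (forall x, `|L x| <= k * `|x|) -> exists g, forall h, L h = inner g h.
Proof.
move=> LD LZ Lk.
pose J u : R := `|u| ^+ 2 / 2 - L u.
have Jlb u : - (k ^+ 2 / 2) <= J u.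
  have h : L u <= k * `|u| := le_trans (ler_norm _) (Lk u).
  have h2 : 0 <= (`|u| - k) ^+ 2 by exact: sqr_ge0.
  rewrite /J; lra.
pose E := range J.
have hE : has_inf E.
  split; first by exists (J 0); exists 0.
  by exists (- (k ^+ 2 / 2)) => _ [u _ <-].
have Jm u : inf E <= J u by apply: ge_inf; [exact: hE.2 | exists u].
have ex_u n : {u | J u < inf E + n.+1%:R^-1}.
  apply: cid; have [|_ [u _ <-] Ju] := @inf_adherent _ E n.+1%:R^-1 _ hE.
    by rewrite invr_gt0.
  by exists u.
pose u n := sval (ex_u n).
have Ju n : J (u n) < inf E + n.+1%:R^-1 by exact: svalP (ex_u n).
have Jhalf n p : `|u n - u p| ^+ 2 <= 4 * (n.+1%:R^-1 + p.+1%:R^-1).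
  (* Parallelogram identity: [J] at the midpoint is at least [inf E]. *)
  have := Jm (2^-1 *: (u n + u p)); have := Ju n; have := Ju p.
  rewrite /J LZ LD normrZ exprMn ger0_norm; last by rewrite invr_ge0.
  rewrite sqr_normB sqr_normD; move: n.+1%:R^-1 p.+1%:R^-1 => a b; lra.
have cu : cauchy (u @ \oo).
  apply: cauchy_exP => e e0.
  pose N := Num.truncn (8 * (e ^+ 2)^-1).
  have hN : 8 * N.+1%:R^-1 < e ^+ 2.
    rewrite ltr_pdivrMr// mulrC -ltr_pdivrMr ?exprn_gt0//.
    by rewrite truncnS_gt.
  exists (u N); exists N => // n /= Nn.
  rewrite /= -ball_normE /= -(@ltr_pXn2r _ 2)// ?nnegrE ?(ltW e0)//.
  apply: le_lt_trans (Jhalf _ _) _; apply: le_lt_trans hN.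
  have : n.+1%:R^-1 <= N.+1%:R^-1 :> R; first by rewrite lef_pV2 ?posrE// ler_nat ltnS.
  move: n.+1%:R^-1 N.+1%:R^-1 => a b; lra.
have /cauchy_cvg ug := cu.
set g := lim (u @ \oo) in ug.
exists g => h; apply/eqP; rewrite eq_sym -subr_eq0 -normr_le0.
set a := inner g h - L h.
apply/ler_addgt0Pl => e e0; rewrite addr0.
set B := 1 + `|h| + `|h| ^+ 2 / 2.
have B0 : 0 < B by rewrite /B; have := normr_ge0 h; nra.
pose d := e / B; have d0 : 0 < d by rewrite divr_gt0.
have [n [un nd]] : exists n, `|g - u n| <= d /\ n.+1%:R^-1 <= d ^+ 2.
  have d20 : 0 < d ^+ 2 by rewrite exprn_gt0.
  have /cvgrPdist_le /(_ d d0) H1 := ug.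
  have [n [? ?]] := filter_ex (filterI H1 (near_infty_natSinv_lt (PosNum d20))).
  by exists n; split=> //; exact: ltW.
(* Compare [J] at [u n] and at [u n + d s h] for a sign [s]: the increment of
   size [d] makes both the quadratic term and the defect [d ^+ 2] of [u n]
   negligible against the linear one. *)
have key s : s ^+ 2 = 1 -> `|s| = 1 -> - (d * B) <= s * a.
  move=> s2 s1; rewrite -(ler_pM2l d0).
  have := Jm (u n + (d * s) *: h); have := Ju n; rewrite /J LD LZ.
  rewrite sqr_normD innerZr normrZ normrM s1 mulr1 (gtr0_norm d0).
  have : (d * s) * inner (u n - g) h <= d * (d * `|h|).
    apply: le_trans (ler_norm _) _; rewrite 2!normrM s1 mulr1 (gtr0_norm d0).
    rewrite ler_pM2l//; apply: le_trans (normr_inner_le _ _) _.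
    by rewrite ler_wpM2r// distrC.
  rewrite innerBl /a /B; move: n.+1%:R^-1 nd => ?; lra.
have := key 1 (expr1n _ _) (normr1 _).
have := key (-1); rewrite sqrrN expr1n normrN1 => /(_ erefl erefl).
rewrite divfK ?gt_eqF// mulN1r mul1r lerN2 ler_norml => -> ->.
by [].
Qed.

End InnerProduct.

(** * Gradients *)

Section GradientExpansion.
Context {R : realType} {X : hilbertType R}.
Implicit Types (F : X -> R) (x g h : X).

Lemma inner_is_linear g : linear (inner g : X -> R^o).
Proof. by move=> c x y; rewrite innerDr innerZr. Qed.

HB.instance Definition _ g :=
  GRing.isLinear.Build R X R^o *:%R (inner g : X -> R^o) (inner_is_linear g).

Lemma inner_continuous g : continuous (inner g : X -> R^o).
Proof.
apply/linear_bounded_continuous/linear_boundedP.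
exists `|g|; split; first exact: normr_real.
move=> r gr x; apply: le_trans (normr_inner_le g x) _.
by rewrite ler_wpM2r// ltW.
Qed.

(** The default value in the definition of the gradient is never reached at a
point of differentiability, by the Riesz representation theorem. *)
Lemma diff_gradient F x : differentiable F x ->
  forall h, 'd F x h = inner (gradient F x) h.
Proof.
move=> dF; rewrite /gradient.
have : exists g, [set g : X | forall h : X, 'd F x h = inner g h] g.
  have [k k0 Hk] := linear_lipschitz (diff_continuous dF).
  apply: (@riesz _ _ ('d F x) k) => //.
    exact: linearD.
  by move=> c y; rewrite linearZ.
by case=> g Hg; exact: (xgetPex 0 (ex_intro _ g Hg)).
Qed.

(** Since the expansion on the right determines the differential, it can be
verified with a candidate vector [g] before [F] is known to be
differentiable. *)
Lemma gradientP F x g :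
  (differentiable F x /\ gradient F x = g) <->
  (forall e, 0 < e -> exists2 d, 0 < d &
     forall h, `|h| <= d -> `|F (x + h) - F x - inner g h| <= e * `|h|).
Proof.
split=> [[dF <-] e e0|H].
  have /diff_locally/eqaddoP/(_ e e0) := dF.
  move=> /nbhs_normP[d /= d0 Hd]; exists (d / 2); first by rewrite divr_gt0.
  move=> h hd; have := Hd h; rewrite /= sub0r normrN !fctE /= [h + x]addrC.
  rewrite diff_gradient// opprD addrA; apply.
  by apply: le_lt_trans hd _; rewrite ltr_pdivrMr// ltr_pMr// ltr1n.
have oF : F \o shift x = cst (F x) + inner g +o_ 0 id.
  apply/eqaddoP => e e0; have [d d0 Hd] := H e e0.
  apply/nbhs_normP; exists d => // h /=; rewrite sub0r normrN => hd.
  by rewrite !fctE /= [h + x]addrC opprD addrA; apply/Hd/ltW.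
have dE : 'd F x = inner g :> (X -> R).
  exact: (diff_unique (@inner_continuous g) oF).
have dF : differentiable F x.
  apply/diff_locallyP; rewrite dE; split => //; exact: inner_continuous.
split=> //; apply: inner_inj => h.
by rewrite -diff_gradient// dE.
Qed.

End GradientExpansion.

(** * Convex functions with small second differences are of class C1 *)

Section ConvexC1.
Context {R : realType} {X : hilbertType R}.
Implicit Types (F : X -> R) (x y g h : X).

(** Convexity with real scalars instead of elements of the interval type. *)
Definition convex_ineq F := forall t x y, 0 <= t -> t <= 1 ->
  F (t *: x + (1 - t) *: y) <= t * F x + (1 - t) * F y.

Lemma convex_functionP F : convex_function setT F <-> convex_ineq F.
Proof.
split=> [cF t x y t0 t1|cF t x y _ _]; last exact: cF.
have t01 : Itv.spec (@Itv.num_sem R) (Itv.Real `[0, 1]%Z) t.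
  by rewrite /= /Itv.num_sem /= in_itv/= t0 t1 num_real.
by have := cF (Itv.mk t01) x y (in_setT _) (in_setT _).
Qed.

(** Convexity along the segment bounds [F (x + t h) - F x] by [t] times
[F y - F x]; dividing by a small [t] leaves the directional derivative. *)
Lemma convex_gradient_le F x y : convex_ineq F -> differentiable F x ->
  F x + inner (gradient F x) (y - x) <= F y.
Proof.
move=> cF dF; have [H _] := gradientP F x (gradient F x).
have {}H := H (conj dF erefl).
set h := y - x; set g := gradient F x in H *.
apply/ler_addgt0Pl => e e0.
have n0 : 0 < `|h| + 1 by rewrite ltr_wpDl.
have [d d0 Hd] := H (e / (`|h| + 1)) (divr_gt0 e0 n0).
pose t := Num.min 1 (d / (`|h| + 1)).
have t0 : 0 < t by rewrite lt_min ltr01 divr_gt0.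
have t1 : t <= 1 by rewrite ge_min lexx.
have td : `|t *: h| <= d.
  rewrite normrZ gtr0_norm//; have : t <= d / (`|h| + 1) by rewrite ge_min lexx orbT.
  rewrite ler_pdivlMr// => td; apply: le_trans td.
  by rewrite ler_pM2l// lerDl.
have := Hd _ td; rewrite ler_norml => /andP[H1 _].
have H2 := cF t y x (ltW t0) t1.
have E : t *: y + (1 - t) *: x = x + t *: h.
  by rewrite /h scalerBr scalerBl scale1r addrC -addrA [- _ + _]addrC.
rewrite E in H2.
rewrite normrZ gtr0_norm// innerZr in H1.
have H3 : e / (`|h| + 1) * (t * `|h|) <= t * e.
  rewrite -mulrA [leRHS]mulrC ler_pM2l// mulrC -mulrA ler_piMr ?(ltW t0)//.
  by rewrite ler_pdivrMr// mul1r lerDl.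
rewrite -(ler_pM2l t0); lra.
Qed.

(** A second supporting affine function with slope [g] would exceed [F] at
first order in the direction [g - gradient F x]. *)
Lemma gradient_unique F x g : differentiable F x ->
  (forall y, F x + inner g (y - x) <= F y) -> gradient F x = g.
Proof.
move=> dF Hg; have [H _] := gradientP F x (gradient F x).
have {}H := H (conj dF erefl).
apply/esym/subr0_eq/normr0_eq0/le_anti; rewrite normr_ge0 andbT.
apply/ler_addgt0Pl => e e0; rewrite addr0.
have [d d0 Hd] := H e e0.
apply: (norm_le_inner d0) (ltW e0) => h hd.
have := Hd h; rewrite hd => /(_ (lexx _)); rewrite ler_norml => /andP[_ H1].
have := Hg (x + h); rewrite addrAC subrr add0r innerBl; lra.
Qed.

(** For continuous convex functions this is uniform Frechet differentiability, since a
second difference dominates the error of the first-order expansion. It mentions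
no derivative and is therefore stable under infima and convex envelopes. *)
Definition uniformly_smooth F := forall e, 0 < e -> exists2 d, 0 < d &
  forall x h, `|h| <= d -> F (x + h) + F (x - h) <= 2 * F x + e * `|h|.

(** The one-sided directional derivative [D h] is the infimum of the difference
quotients. Convexity makes it sublinear, smoothness makes it odd; being linear
and bounded it is represented by a vector. *)
Lemma convex_smooth_subgradient F k x : convex_ineq F -> uniformly_smooth F ->
  (forall y z, F y <= F z + k * `|y - z|) ->
  exists g, forall h, F x + inner g h <= F (x + h).
Proof.
move=> cF sF lF.
pose q h t := (F (x + t *: h) - F x) / t.
have qub h t : 0 < t -> q h t <= k * `|h|.
  move=> t0; rewrite ler_pdivrMr//.
  have := lF (x + t *: h) x; rewrite addrAC subrr add0r normrZ gtr0_norm//; lra.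
have qlb h t : 0 < t -> - (k * `|h|) <= q h t.
  move=> t0; rewrite ler_pdivlMr//.
  have := lF x (x + t *: h); rewrite opprD addrA subrr add0r normrN normrZ.
  rewrite gtr0_norm//; lra.
have qmon h s t : 0 < s -> s <= t -> q h s <= q h t.
  move=> s0 st; have t0 := lt_le_trans s0 st.
  rewrite ler_pdivrMr// /q.
  have := cF (s / t) (x + t *: h) x; rewrite divr_ge0 ?(ltW s0) ?(ltW t0)//.
  rewrite ler_pdivrMr// mul1r => /(_ erefl st).
  have -> : s / t *: (x + t *: h) + (1 - s / t) *: x = x + s *: h.
    rewrite scalerDr scalerA divfK ?gt_eqF// scalerBl scale1r.
    by rewrite addrAC addrCA subrr addr0.
  move: (F _) (F _) (F _) => a b c H.
  by rewrite -mulrA [t^-1 * s]mulrC [(b - a) * _]mulrC; lra.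
pose D h := inf [set q h t | t in [set t | 0 < t]].
have hD h : has_inf [set q h t | t in [set t | 0 < t]].
  split; first by exists (q h 1); exists 1 => //=; exact: ltr01.
  by exists (- (k * `|h|)) => _ [t t0 <-]; exact: qlb.
have Dq h t : 0 < t -> D h <= q h t.
  by move=> t0; apply: ge_inf; [exact: (hD h).2 | exists t].
have qD h e : 0 < e -> exists2 t, 0 < t & forall s, 0 < s -> s <= t -> q h s <= D h + e.
  move=> e0; have [_ [t /= t0 <-] Ht] := inf_adherent e0 (hD h).
  exists t => // s s0 st; exact: le_trans (qmon h _ _ s0 st) (ltW Ht).
have Dsub h1 h2 : D (h1 + h2) <= D h1 + D h2.
  apply/ler_addgt0Pl => e e0.
  have e20 : 0 < e / 2 by rewrite divr_gt0.
  have [t1 t10 H1] := qD h1 _ e20; have [t2 t20 H2] := qD h2 _ e20.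
  pose t := Num.min t1 t2.
  have t0 : 0 < t by rewrite lt_min t10.
  have t20' : 0 < t / 2 by rewrite divr_gt0.
  have := H1 t t0; rewrite ge_min lexx => /(_ erefl) {}H1.
  have := H2 t t0; rewrite ge_min lexx orbT => /(_ erefl) {}H2.
  apply: le_trans (Dq _ _ t20') _.
  have : q (h1 + h2) (t / 2) <= q h1 t + q h2 t.
    rewrite /q ler_pdivrMr//.
    have := cF 2^-1 (x + t *: h1) (x + t *: h2).
    rewrite invr_ge0 ler0n invf_le1 ?ltr0n// ler1n => /(_ erefl erefl).
    have -> : (1 - 2^-1 : R) = 2^-1 by lra.
    have -> : 2^-1 *: (x + t *: h1) + 2^-1 *: (x + t *: h2) =
        x + (t / 2) *: (h1 + h2).
      rewrite !scalerDr !scalerA addrACA -scalerDl [2^-1 * t]mulrC.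
      have -> : 2^-1 + 2^-1 = 1 :> R by lra.
      by rewrite scale1r.
    move: (F _) (F _) (F _) => a b c.
    rewrite -mulrDl mulrA divfK ?gt_eqF//; lra.
  lra.
have D0 : D 0 = 0.
  rewrite /D (_ : [set _ | _ in _] = [set 0]) ?inf1//.
  apply/seteqP; split=> [_ [t _ <-]|_ ->] /=.
    by rewrite /q scaler0 addr0 subrr mul0r.
  by exists 1; [exact: ltr01 | rewrite /q scaler0 addr0 subrr mul0r].
have DN h : D (- h) = - D h.
  apply/le_anti/andP; split; last first.
    by rewrite lerNl -subr_ge0 opprK -D0 -(subrr h); exact: Dsub.
  rewrite -subr_le0 opprK; apply/ler_addgt0Pl => e e0; rewrite addr0.
  have n0 : 0 < `|h| + 1 by rewrite ltr_wpDl.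
  have [d d0 Hd] := sF _ (divr_gt0 e0 n0).
  pose t := d / (`|h| + 1); have t0 : 0 < t by rewrite divr_gt0.
  have td : `|t *: h| <= d.
    rewrite normrZ gtr0_norm// mulrAC ler_pdivrMr// ler_pM2l//.
    by rewrite lerDl.
  apply: le_trans (lerD (Dq _ _ t0) (Dq _ _ t0)) _.
  rewrite /q -mulrDl ler_pdivrMr// scalerN.
  have := Hd x _ td; rewrite normrZ gtr0_norm//.
  have : e / (`|h| + 1) * (t * `|h|) <= e * t.
    rewrite -mulrA ler_pM2l// mulrC -mulrA ler_piMr ?(ltW t0)//.
    by rewrite ler_pdivrMr// mul1r lerDl.
  lra.
have DD h1 h2 : D (h1 + h2) = D h1 + D h2.
  apply/le_anti; rewrite Dsub/=.
  by have := Dsub (- h1) (- h2); rewrite -opprD !DN; lra.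
have DZp c h : 0 < c -> D (c *: h) <= c * D h.
  move=> c0; rewrite -ler_pdivrMl//; apply: lb_le_inf => [|_ [t /= t0 <-]].
    exact: (hD h).1.
  rewrite ler_pdivrMl//; have tc0 : 0 < t / c by rewrite divr_gt0.
  apply: le_trans (Dq _ _ tc0) _.
  by rewrite /q scalerA divfK ?gt_eqF// invf_div mulrCA.
have DZpos c h : 0 < c -> D (c *: h) = c * D h.
  move=> c0; apply/le_anti; rewrite DZp//=.
  rewrite -ler_pdivlMl//; have ci0 : 0 < c^-1 by rewrite invr_gt0.
  have := DZp _ (c *: h) ci0.
  by rewrite scalerA mulVf ?gt_eqF// scale1r.
have DZ c h : D (c *: h) = c * D h.
  have [c0|c0|->] := ltgtP c 0; last by rewrite scale0r D0 mul0r.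
    by rewrite -{1}[c]opprK scaleNr DN DZpos ?oppr_gt0// mulNr opprK.
  exact: DZpos.
have DL h : `|D h| <= k * `|h|.
  rewrite ler_norml (le_trans (Dq _ _ ltr01) (qub _ _ ltr01)) andbT.
  apply: lb_le_inf; first exact: (hD h).1.
  by move=> _ [t t0 <-]; exact: qlb.
have [g Hg] := riesz DD DZ DL.
exists g => h; rewrite -Hg.
by have := Dq h 1 ltr01; rewrite /q scale1r divr1; lra.
Qed.

(** A subgradient is a gradient because the second difference controls the
upper half of the expansion. The same bound, used at two points at distance
[r] with an increment of length [r], controls the variation of the gradient. *)
Lemma convex_smooth_C1 F k : convex_ineq F -> uniformly_smooth F ->
  (forall y z, F y <= F z + k * `|y - z|) -> C1 F.
Proof.
move=> cF sF lF.
have exg x : exists g, forall h, F x + inner g h <= F (x + h).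
  exact: convex_smooth_subgradient cF sF lF.
have dF x : differentiable F x.
  have [g Hg] := exg x; apply: (proj1 ((gradientP F x g).2 _)) => e e0.
  have [d d0 Hd] := sF e e0; exists d => // h hd.
  have := Hd x h hd; have := Hg h; have := Hg (- h); rewrite innerNr => *.
  by rewrite ler_norml; apply/andP; split; have := mulr_ge0 (ltW e0) (normr_ge0 h); lra.
split=> // x; apply/cvgrPdist_le => e e0.
have e20 : 0 < e / 2 by rewrite divr_gt0.
have [d d0 Hd] := sF _ e20.
apply/nbhs_normP; exists d => // y /= xyd.
have [->|xy] := eqVneq x y; first by rewrite subrr normr0 ltW.
have r0 : 0 < `|x - y| by rewrite normr_gt0 subr_eq0.
apply: (norm_le_inner r0) (ltW e0) => h hr.
(* Compare [F] at [y + h] with its support at [x], and [F] at [y] with its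
   expansion there; the increment [h] has the length of [x - y]. *)
have Hx z := convex_gradient_le z cF (dF x).
have Hy z := convex_gradient_le z cF (dF y).
have H1 := Hx (y + h); have H2 := Hy (y - h).
have H3 := Hd y h; rewrite hr in H3; have {}H3 := H3 (ltW xyd).
have H4 := Hx (x - (y - x)).
have H6 := Hd x (y - x); rewrite distrC in H6; have {}H6 := H6 (ltW xyd).
have E1 : y + h - x = (y - x) + h by rewrite addrAC.
have E2 : y - h - y = - h by rewrite addrAC subrr add0r.
have E3 : x - (y - x) - x = - (y - x) by rewrite addrAC subrr add0r.
have E4 : x + (y - x) = y by rewrite addrC subrK.
rewrite E1 innerDr in H1; rewrite E2 innerNr in H2; rewrite E3 innerNr in H4.
rewrite E4 in H6; rewrite innerBl.
move: H1 H2 H3 H4 H6; move: (F _) (F _) (F _) (F _) (F _).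
move: (inner _ _) (inner _ _) (inner _ _) `|x - y|; clear => *; lra.
Qed.

End ConvexC1.

(** * Convex envelopes *)

Section ConvexEnvelope.
Context {R : realType} {X : hilbertType R}.
Implicit Types (F g p : X -> R) (x y h : X).

Lemma convex_ineq_shift F h c : convex_ineq F ->
  convex_ineq (fun x => F (x + h) + c).
Proof.
move=> cF t x y t0 t1; have := cF t (x + h) (y + h) t0 t1.
have -> : t *: (x + h) + (1 - t) *: (y + h) = t *: x + (1 - t) *: y + h.
  by rewrite !scalerDr addrACA -scalerDl addrC [t + _]addrC subrK scale1r addrC.
lra.
Qed.

Lemma convex_ineq_half F g : convex_ineq F -> convex_ineq g ->
  convex_ineq (fun x => (F x + g x) / 2).
Proof.
by move=> cF cg t x y t0 t1; have := cF t x y t0 t1; have := cg t x y t0 t1; lra.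
Qed.

Definition convex_minorant g p := convex_ineq p /\ forall x, p x <= g x.

(** Taking all convex minorants, rather than the affine ones or the convex
combinations of values of [g], makes the envelope maximal by definition: a
property of [g] is inherited by exhibiting one convex minorant. *)
Definition convex_envelope g x := sup [set p x | p in convex_minorant g].

Variables (g p0 : X -> R).
Hypothesis gp0 : convex_minorant g p0.

Let has_sup_minorants x : has_sup [set p x | p in convex_minorant g].
Proof.
split; first by exists (p0 x); exists p0.
by exists (g x) => _ [p [_ pg] <-]; exact: pg.
Qed.

Lemma convex_envelope_ge p x : convex_minorant g p -> p x <= convex_envelope g x.
Proof. by move=> gp; apply: sup_upper_bound => //; exists p. Qed.

Lemma convex_envelope_le x : convex_envelope g x <= g x.
Proof.
apply: ge_sup; first exact: (has_sup_minorants x).1.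
by move=> _ [p [_ pg] <-]; exact: pg.
Qed.

Lemma convex_envelope_convex : convex_ineq (convex_envelope g).
Proof.
move=> t x y t0 t1; apply: ge_sup; first exact: (has_sup_minorants _).1.
move=> _ [p gp <-]; apply: le_trans (gp.1 t x y t0 t1) _.
by rewrite lerD// ler_wpM2l ?subr_ge0//; exact: convex_envelope_ge.
Qed.

(** The translate of the envelope by [x - y], lowered by [k * `|x - y|], is a
convex minorant of [g]. *)
Lemma convex_envelope_lipschitz k :
  (forall x y, g x <= g y + k * `|x - y|) ->
  forall x y, convex_envelope g x <= convex_envelope g y + k * `|x - y|.
Proof.
move=> lg x y.
pose p z := convex_envelope g (z + (x - y)) + - (k * `|x - y|).
have gp : convex_minorant g p.
  split; first exact/convex_ineq_shift/convex_envelope_convex.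
  move=> z; rewrite /p lerBlDr; apply: le_trans (convex_envelope_le _) _.
  by have := lg (z + (x - y)) z; rewrite [z + _ - z]addrAC subrr add0r.
have := convex_envelope_ge y gp.
by rewrite /p [y + _]addrC subrK lerBlDr.
Qed.

(** The average of the two translates by [h] and [- h], lowered by half of
[e * `|h|], is a convex minorant of [g]. *)
Lemma convex_envelope_smooth :
  uniformly_smooth g -> uniformly_smooth (convex_envelope g).
Proof.
move=> sg e e0; have [d d0 Hd] := sg e e0; exists d => // x h hd.
pose p z := (convex_envelope g (z + h) + 0 +
             (convex_envelope g (z + - h) + - (e * `|h|))) / 2.
have gp : convex_minorant g p.
  split.
    by apply: convex_ineq_half; apply/convex_ineq_shift/convex_envelope_convex.
  move=> z; have := Hd z h hd; rewrite /p.
  by have := convex_envelope_le (z + h); have := convex_envelope_le (z - h); lra.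
by have := convex_envelope_ge x gp; rewrite /p; lra.
Qed.

End ConvexEnvelope.

(** * The upper envelope of tangents *)

Section QuadraticProfile.
Context {R : realType} {X : hilbertType R}.
Variables (K : set X) (f : X -> R) (G : X -> X) (M : R).
Implicit Types (x y z h : X) (s t u v a b c e : R).

Definition tangent y x := f y + inner (G y) (x - y).

(** If every [eta > 0] admits some [c], then the supremum of the tangents is
differentiable at the points of [K], uniformly: this is the form in which (ii)
is used. *)
Definition tangent_spread eta c := forall x y z, K y -> K z ->
  tangent z x <= tangent y x + eta * `|x - y| + c * `|x - y| ^+ 2.

Definition majorant_coefs := [set ab : R * R | [/\ 0 <= ab.1, 0 <= ab.2 &
  forall x y z, K y -> K z ->
    tangent z x <= tangent y x + (ab.1 + ab.2 * `|x - y| ^+ 2)]].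

(** The least function of the distance to the point of contact that puts each
tangent above all the others when added to it, among those that are
nondecreasing and concave in the square of the distance. Quadratics have constant second differences in a Hilbert space, which
is why they are the building blocks. *)
Definition profile t := inf [set ab.1 + ab.2 * t ^+ 2 | ab in majorant_coefs].

Hypothesis M0 : 0 <= M.
Hypothesis spreadM : tangent_spread (2 * M) 0.

(** Young's inequality replaces [eta * w] by the quadratic in [w] that touches
it at [w = s]. *)
Lemma tangent_spread_coefs eta c s : 0 <= eta -> 0 <= c -> 0 < s ->
  tangent_spread eta c -> majorant_coefs (eta * s / 2, c + eta / (2 * s)).
Proof.
move=> eta0 c0 s0 H; split => /=.
- by rewrite divr_ge0// mulr_ge0// ltW.
- by rewrite addr_ge0// divr_ge0// mulr_ge0// ltW.
move=> x y z Ky Kz; apply: le_trans (H x y z Ky Kz) _.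
rewrite -addrA lerD2l; move: (`|x - y|) => w.
have -> : eta * s / 2 + (c + eta / (2 * s)) * w ^+ 2 =
  eta * w + c * w ^+ 2 + eta * (w - s) ^+ 2 / (2 * s).
  by field; rewrite gt_eqF.
by rewrite lerDl divr_ge0// mulr_ge0// ?sqr_ge0// ltW.
Qed.

Let has_inf_profile t : has_inf [set ab.1 + ab.2 * t ^+ 2 | ab in majorant_coefs].
Proof.
split.
  have /tangent_spread_coefs/(_ (lexx _) ltr01 spreadM) H : 0 <= 2 * M.
    by rewrite mulr_ge0.
  by eexists; eexists; first exact: H.
exists 0 => _ [[a b] [/= a0 b0 _] <-].
by rewrite addr_ge0// mulr_ge0// sqr_ge0.
Qed.

Lemma profile_le a b t : majorant_coefs (a, b) -> profile t <= a + b * t ^+ 2.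
Proof. by move=> H; apply: ge_inf; [exact: (has_inf_profile t).2 | exists (a, b)]. Qed.

Lemma profile_ge t c :
  (forall a b, majorant_coefs (a, b) -> c <= a + b * t ^+ 2) -> c <= profile t.
Proof.
move=> H; apply: lb_le_inf; first exact: (has_inf_profile t).1.
by move=> _ [[a b] ab <-]; exact: H.
Qed.

Lemma profile_ge0 t : 0 <= profile t.
Proof.
by apply: profile_ge => a b [/= ? ? _]; rewrite addr_ge0// mulr_ge0// sqr_ge0.
Qed.

Lemma tangent_le_profile x y z : K y -> K z ->
  tangent z x <= tangent y x + profile `|x - y|.
Proof.
move=> Ky Kz; rewrite -lerBlDl; apply: profile_ge => a b [_ _ H].
by rewrite lerBlDl; exact: H.
Qed.

Lemma profile_spread eta c t : 0 <= eta -> 0 <= c -> 0 <= t ->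
  tangent_spread eta c -> profile t <= eta * t + c * t ^+ 2.
Proof.
move=> eta0 c0; rewrite le_eqVlt => /predU1P[<- H|t0 H]; last first.
  apply: le_trans (profile_le _ (tangent_spread_coefs eta0 c0 t0 H)) _.
  by rewrite le_eqVlt; apply/orP; left; apply/eqP; field; rewrite gt_eqF.
rewrite expr0n/= !mulr0 addr0; apply/ler_addgt0Pl => e e0; rewrite addr0.
have n0 : 0 < eta + 1 by rewrite ltr_wpDl.
pose s := e / (eta + 1); have s0 : 0 < s by rewrite divr_gt0.
apply: le_trans (profile_le _ (tangent_spread_coefs eta0 c0 s0 H)) _.
have es : s * (eta + 1) = e by rewrite divfK ?gt_eqF.
have := mulr_ge0 eta0 (ltW s0); rewrite expr0n/= mulr0 addr0 -es; lra.
Qed.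

(** As a function of the square of its argument the profile is concave and
vanishes at [0]; this is the chord inequality that it therefore satisfies. *)
Lemma profile_ratio t u v : 2 * t ^+ 2 <= u ^+ 2 + v ^+ 2 ->
  (profile u + profile v) * t ^+ 2 <= profile t * (u ^+ 2 + v ^+ 2).
Proof.
move=> tuv; have [->|t0] := eqVneq t 0.
  by rewrite expr0n/= mulr0 mulr_ge0 ?profile_ge0// addr_ge0 ?sqr_ge0.
have t20 : 0 < t ^+ 2 by rewrite exprn_even_gt0.
have uv0 : 0 < u ^+ 2 + v ^+ 2 by apply: lt_le_trans tuv; rewrite mulr_gt0.
rewrite -ler_pdivrMr//; apply: profile_ge => a b ab; rewrite ler_pdivrMr//.
have [/= a0 b0 _] := ab.
have Hu := profile_le u ab; have Hv := profile_le v ab.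
have : (profile u + profile v) * t ^+ 2 <=
       (2 * a + b * (u ^+ 2 + v ^+ 2)) * t ^+ 2 by rewrite ler_pM2r//; lra.
have := ler_wpM2l a0 tuv; lra.
Qed.

Lemma profile_mono s t : 0 <= s -> s <= t -> profile s <= profile t.
Proof.
move=> s0 st; apply: profile_ge => a b ab; apply: le_trans (profile_le s ab) _.
have [/= _ b0 _] := ab; rewrite lerD2l ler_wpM2l// ler_pXn2r ?nnegrE//.
exact: le_trans st.
Qed.

Lemma profile_le_linear t : 0 <= t -> profile t <= 2 * M * t.
Proof.
move=> t0; have := profile_spread (mulr_ge0 (ler0n _ 2) M0) (lexx 0) t0 spreadM.
by rewrite mul0r addr0.
Qed.

(** Concavity in the square turns the bound [2 * M * t] on the profile into the
bound [4 * M] on its slope. *)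
Lemma profile_lipschitz s t : 0 <= s -> 0 <= t ->
  profile s <= profile t + 4 * M * `|s - t|.
Proof.
move=> s0 t0; have [st|ts] := leP s t.
  apply: le_trans (profile_mono s0 st) _.
  by rewrite lerDl mulr_ge0// mulr_ge0.
have sp : 0 < s := le_lt_trans t0 ts.
rewrite gtr0_norm ?subr_gt0//.
have s20 : 0 < s ^+ 2 by rewrite exprn_gt0.
rewrite -(ler_pM2r s20).
have H1 : profile s * t ^+ 2 <= profile t * s ^+ 2.
  have := @profile_ratio t s s; have : t ^+ 2 <= s ^+ 2.
    by rewrite ler_pXn2r ?nnegrE// ltW.
  by move=> ts2 H; have := H ltac:(lra); lra.
have st0 : 0 <= s - t by rewrite subr_ge0 ltW.
have ts0 : 0 <= (s - t) * (s + t) by rewrite mulr_ge0// addr_ge0.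
have H2 := ler_wpM2r ts0 (profile_le_linear s0).
have H3 : 0 <= 2 * M * s * (s - t) * (s - t).
  by rewrite !mulr_ge0.
move: H1 H2 H3; move: (profile s) (profile t); clear => *; lra.
Qed.

Hypothesis spread_small : forall eta, 0 < eta ->
  exists2 c, 0 <= c & tangent_spread eta c.

(** When [`|z| <= `|h|] the profile is so small at [z + h] and [z - h] that no
cancellation is needed. For larger [z] the parallelogram identity and the chord
inequality bound the second difference by [2 * profile `|z| * (`|h| / `|z|) ^ 2],
where the profile is small compared with [`|z|]. *)
Lemma profile_smooth : uniformly_smooth (fun z : X => profile `|z|).
Proof.
move=> e e0; have e80 : 0 < e / 8 by rewrite divr_gt0.
have [c c0 Hc] := spread_small e80.
have Hp t : 0 <= t -> profile t <= e / 8 * t + c * t ^+ 2.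
  by move=> t0; apply: profile_spread => //; exact: ltW.
have n0 : 0 < 16 * (c + 1) by rewrite mulr_gt0// ltr_wpDl.
pose d := e / (16 * (c + 1)); have d0 : 0 < d by rewrite divr_gt0.
exists d => // z h hd.
have ed : d * (16 * (c + 1)) = e by rewrite divfK ?gt_eqF.
have h0 := normr_ge0 h; have z0 := normr_ge0 z.
have cdh : 8 * c * `|h| ^+ 2 <= e / 2 * `|h|.
  have := ler_wpM2r h0 (ler_wpM2l c0 hd); have := mulr_ge0 (ltW d0) h0.
  by rewrite -ed; lra.
have [zh|hz] := leP `|z| `|h|.
  have H (w : X) : `|w| <= `|z| + `|h| ->
      profile `|w| <= e / 8 * (2 * `|h|) + c * (2 * `|h|) ^+ 2.
    move=> wzh; have wh : `|w| <= 2 * `|h| by lra.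
    apply: le_trans (profile_mono (normr_ge0 w) wh) (Hp _ _).
    by rewrite mulr_ge0.
  have H1 := H (z + h) (ler_normD _ _).
  have H2 := H (z - h) (ler_normB _ _).
  have := profile_ge0 `|z|; move: H1 H2 cdh.
  move: (profile _) (profile _) (profile _) => p1 p2 p3; clear => *; lra.
have zp : 0 < `|z| := le_lt_trans h0 hz.
have par : `|z + h| ^+ 2 + `|z - h| ^+ 2 = 2 * `|z| ^+ 2 + 2 * `|h| ^+ 2.
  by rewrite sqr_normB sqr_normD; lra.
have := @profile_ratio `|z| `|z + h| `|z - h|; rewrite par lerDl.
rewrite mulr_ge0 ?sqr_ge0// => /(_ erefl) H1.
have H2 := Hp _ z0; move: H1 H2 cdh.
move: (profile _) (profile _) (profile _) => p1 p2 p3 H1 H2 cdh.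
rewrite -(ler_pM2r (exprn_gt0 2 zp)).
have hz2 := ler_wpM2r (sqr_ge0 `|h|) H2.
have dhz : 0 <= `|z| - `|h| by rewrite subr_ge0 ltW.
have hz3 : 0 <= e * `|z| * `|h| * (`|z| - `|h|) by rewrite !mulr_ge0// ltW.
have hz4 : 0 <= e * `|h| * `|z| ^+ 2 by rewrite !mulr_ge0// ltW.
have cdz := ler_wpM2l (sqr_ge0 `|z|) cdh.
move: H1 hz2 hz3 hz4 cdz; move: `|z| `|h|; clear => *; lra.
Qed.

(** The profile vanishes at [0], so this function coincides with [f] on [K]
while staying above every tangent. *)
Definition tangent_envelope x := inf [set tangent y x + profile `|x - y| | y in K].

Hypothesis K0 : K !=set0.
Hypothesis GM : forall y, K y -> `|G y| <= M.

Lemma tangent_lip x y z : K y -> tangent y x <= tangent y z + M * `|x - z|.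
Proof.
move=> Ky; rewrite /tangent.
have -> : x - y = (z - y) + (x - z) by rewrite [RHS]addrC addrA subrK.
rewrite innerDr addrA lerD2l; apply: le_trans (inner_le _ _) _.
by rewrite ler_wpM2r// GM.
Qed.

Let has_inf_envelope x :
  has_inf [set tangent y x + profile `|x - y| | y in K].
Proof.
have [y0 Ky0] := K0; split; first by exists (tangent y0 x + profile `|x - y0|); exists y0.
by exists (tangent y0 x) => _ [y Ky <-]; exact: tangent_le_profile.
Qed.

Lemma tangent_envelope_le x y : K y ->
  tangent_envelope x <= tangent y x + profile `|x - y|.
Proof. by move=> Ky; apply: ge_inf; [exact: (has_inf_envelope x).2 | exists y]. Qed.

Lemma tangent_envelope_ge x c :
  (forall y, K y -> c <= tangent y x + profile `|x - y|) ->
  c <= tangent_envelope x.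
Proof.
move=> H; apply: lb_le_inf; first exact: (has_inf_envelope x).1.
by move=> _ [y Ky <-]; exact: H.
Qed.

Lemma tangent_le_envelope x z : K z -> tangent z x <= tangent_envelope x.
Proof.
by move=> Kz; apply: tangent_envelope_ge => y Ky; exact: tangent_le_profile.
Qed.

Lemma tangent_envelope_lipschitz x z :
  tangent_envelope x <= tangent_envelope z + 5 * M * `|x - z|.
Proof.
rewrite -lerBlDr; apply: tangent_envelope_ge => y Ky; rewrite lerBlDr.
apply: le_trans (tangent_envelope_le x Ky) _.
have H1 := tangent_lip x z Ky.
have H2 := profile_lipschitz (normr_ge0 (x - y)) (normr_ge0 (z - y)).
have H3 : `| `|x - y| - `|z - y| | <= `|x - z|.
  apply: le_trans (ler_dist_dist _ _) _.
  by rewrite opprB addrA subrK.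
have H4 : 4 * M * `| `|x - y| - `|z - y| | <= 4 * M * `|x - z|.
  by rewrite ler_wpM2l// mulr_ge0.
lra.
Qed.

(** At [x] the infimum is nearly reached at some [y], whose competitor bounds
the envelope at [x + h] and [x - h]; affine terms have no second difference. *)
Lemma tangent_envelope_smooth : uniformly_smooth tangent_envelope.
Proof.
move=> e e0; have [d d0 Hd] := profile_smooth e0; exists d => // x h hd.
have : (tangent_envelope (x + h) + tangent_envelope (x - h) - e * `|h|) / 2
       <= tangent_envelope x; last by lra.
apply: tangent_envelope_ge => y Ky.
have H1 := tangent_envelope_le (x + h) Ky.
have H2 := tangent_envelope_le (x - h) Ky.
have H3 := Hd (x - y) h hd.
have E1 : x + h - y = x - y + h by rewrite addrAC.
have E2 : x - h - y = x - y - h by rewrite addrAC.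
rewrite /tangent E1 innerDr in H1; rewrite /tangent E2 innerDr innerNr in H2.
rewrite /tangent; lra.
Qed.

End QuadraticProfile.

(** * Jets on a compact set *)

Section CompactJet.
Context {R : realType} {X : hilbertType R}.
Variables (K : set X) (f : X -> R) (G : X -> X).
Hypotheses (K0 : K !=set0) (cK : compact K).
Hypotheses (cf : {within K, continuous f}) (cG : {within K, continuous G}).
Implicit Types (x y z : X) (e eta c : R).

Let bounded_G : has_ubound [set `|G z| | z in K].
Proof.
have cn : {within K, continuous (fun z => `|G z|)}.
  move=> z; apply: cvg_norm; exact: cG.
have [c _ Hc] := compact_EVT_max K0 cK cn.
by exists `|G c| => _ [z Kz <-]; apply: Hc; rewrite inE.
Qed.

Lemma norm_le_sup z : K z -> `|G z| <= sup [set `|G z| | z in K].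
Proof. by move=> Kz; apply: ub_le_sup => //; exists z. Qed.

Hypothesis tangent_le : forall x y, K x -> K y -> tangent f G y x <= f x.
Hypothesis tangent_eq : forall x y, K x -> K y ->
  f x = tangent f G y x -> G x = G y.

(** The term [w + `|w|] is positive where the slopes are closer than [eta] and
zero elsewhere. Added to the gap it gives a continuous function that is positive
on all of [K `*` K], whose minimum is the required constant. *)
Lemma tangent_gap eta : 0 < eta -> exists2 c, 0 < c &
  forall y z, K y -> K z -> eta <= `|G y - G z| -> tangent f G z y + c <= f y.
Proof.
move=> eta0.
pose w (p : X * X) := eta - `|G p.1 - G p.2|.
pose q (p : X * X) := f p.1 - tangent f G p.2 p.1 + (w p + `|w p|).
have cq : {within K `*` K, continuous q}.
  apply/subspace_continuousP => -[y z] [/= Ky Kz].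
  have wK1 : fst @ within (K `*` K) (nbhs (y, z)) --> within K (nbhs y).
    move=> A HA; have H : nbhs (y, z) [set p | K p.1 -> A p.1].
      exact: (@cvg_fst _ _ (nbhs y) (nbhs z) _ _ HA).
    by apply: filterS H => p Hp [Kp _]; exact: Hp.
  have wK2 : snd @ within (K `*` K) (nbhs (y, z)) --> within K (nbhs z).
    move=> A HA; have H : nbhs (y, z) [set p | K p.2 -> A p.2].
      exact: (@cvg_snd _ _ (nbhs y) (nbhs z) _ _ HA).
    by apply: filterS H => p Hp [_ Kp]; exact: Hp.
  have w1 : fst @ within (K `*` K) (nbhs (y, z)) --> y.
    exact: cvg_trans wK1 (cvg_within _).
  have w2 : snd @ within (K `*` K) (nbhs (y, z)) --> z.
    exact: cvg_trans wK2 (cvg_within _).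
  have [/subspace_continuousP f_ /subspace_continuousP G_] := (cf, cG).
  have f1 : f p.1 @[p --> within (K `*` K) (nbhs (y, z))] --> f y.
    exact: cvg_comp wK1 (f_ _ Ky).
  have f2 : f p.2 @[p --> within (K `*` K) (nbhs (y, z))] --> f z.
    exact: cvg_comp wK2 (f_ _ Kz).
  have G1 : G p.1 @[p --> within (K `*` K) (nbhs (y, z))] --> G y.
    exact: cvg_comp wK1 (G_ _ Ky).
  have G2 : G p.2 @[p --> within (K `*` K) (nbhs (y, z))] --> G z.
    exact: cvg_comp wK2 (G_ _ Kz).
  have w_ : w p @[p --> within (K `*` K) (nbhs (y, z))] --> w (y, z).
    by apply: cvgB; [exact: cvg_cst | exact: (cvg_norm (cvgB G1 G2))].
  apply: cvgD.
    apply: cvgB => //; apply: cvgD => //; apply: cvg_inner => //.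
    exact: cvgB.
  by apply: cvgD => //; exact: (cvg_norm w_).
have KK0 : K `*` K !=set0 by have [y Ky] := K0; exists (y, y).
have [[y z]] := compact_EVT_min KK0 (compact_setX cK cK) cq.
rewrite inE => -[/= Ky Kz] Hmin.
exists (q (y, z)) => [|y' z' Ky' Kz' H].
  have gap0 : 0 <= f y - tangent f G z y by rewrite subr_ge0 tangent_le.
  have [w0|w0] := ltP 0 (w (y, z)).
    by rewrite /q /= ltr_wpDl// ltr_wpDr.
  rewrite /q /= ltr_pwDl// ?lt_neqAle ?gap0 ?andbT; last first.
    by rewrite ler0_norm// subrr.
  rewrite eq_sym subr_eq0; apply/eqP => /(tangent_eq Ky Kz) GE.
  by move: w0; rewrite /w /= GE subrr normr0 subr0 leNgt eta0.
have := Hmin (y', z'); rewrite inE => /(_ (conj Ky' Kz')).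
rewrite {2}/q /= ler0_norm ?subr_le0// subrr addr0; lra.
Qed.

Let M := sup [set `|G z| | z in K].

Lemma sup_norm_ge0 : 0 <= M.
Proof. by have [z Kz] := K0; exact: le_trans (norm_le_sup Kz). Qed.

(** The difference of two tangents, expanded at the point of contact [y] of one
of them, is a nonpositive gap plus a linear term. *)
Lemma tangentB x y z :
  tangent f G z x - tangent f G y x =
  tangent f G z y - f y + inner (G z - G y) (x - y).
Proof.
rewrite /tangent (_ : x - z = (y - z) + (x - y)).
  by rewrite innerDr innerBl; lra.
by rewrite [RHS]addrC addrA subrK.
Qed.

Lemma tangent_slope_le x y z : K y -> K z ->
  inner (G z - G y) (x - y) <= 2 * M * `|x - y|.
Proof.
move=> Ky Kz; apply: le_trans (inner_le _ _) _; rewrite ler_wpM2r//.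
apply: le_trans (ler_normB _ _) _.
by have := norm_le_sup Ky; have := norm_le_sup Kz; rewrite -/M; lra.
Qed.

Lemma tangent_spread_sup : tangent_spread K f G (2 * M) 0.
Proof.
move=> x y z Ky Kz; rewrite mul0r addr0 -lerBlDl tangentB.
by have := tangent_slope_le x Ky Kz; have := tangent_le Ky Kz; lra.
Qed.

(** If the slopes of two tangents differ by less than [eta] the linear term
suffices; if not, they are a distance [c] apart at [y], and [2 * M * t - c] is at
most [M ^ 2 / c * t ^ 2] by completing the square. *)
Lemma tangent_spread_small eta : 0 < eta ->
  exists2 c, 0 <= c & tangent_spread K f G eta c.
Proof.
move=> eta0; have [c c0 Hc] := tangent_gap eta0.
exists (M ^+ 2 / c) => [|x y z Ky Kz].
  by rewrite divr_ge0 ?sqr_ge0// ltW.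
rewrite -addrA -lerBlDl tangentB.
have [GE|GE] := leP eta `|G y - G z|.
  have H1 := Hc _ _ Ky Kz GE; have H2 := tangent_slope_le x Ky Kz.
  have H3 : 2 * M * `|x - y| <= c + M ^+ 2 / c * `|x - y| ^+ 2.
    rewrite -subr_ge0 (_ : _ - _ = (c - M * `|x - y|) ^+ 2 / c).
      by rewrite divr_ge0 ?sqr_ge0// ltW.
    by field; rewrite gt_eqF.
  have H4 : 0 <= eta * `|x - y| by rewrite mulr_ge0// ltW.
  lra.
have H1 := tangent_le Ky Kz.
have H2 : inner (G z - G y) (x - y) <= eta * `|x - y|.
  apply: le_trans (inner_le _ _) _; rewrite ler_wpM2r//.
  by rewrite distrC ltW.
have H3 : 0 <= M ^+ 2 / c * `|x - y| ^+ 2.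
  by rewrite mulr_ge0 ?sqr_ge0// divr_ge0 ?sqr_ge0// ltW.
lra.
Qed.

Lemma convex_C1_extension_exists : exists F : X -> R,
  [/\ convex_C1_extension K f G F, lipschitz F & Lip F <= 5 * M].
Proof.
have M0 := sup_norm_ge0; have sM := tangent_spread_sup.
have sS := tangent_spread_small.
pose g := tangent_envelope K f G.
have tcv z : K z -> convex_minorant g (tangent f G z).
  move=> Kz; split=> [t x y _ _|x]; last exact: (tangent_le_envelope M0 sM K0).
  rewrite /tangent !innerBr innerDr !innerZr; lra.
have [z0 Kz0] := K0; have gz0 := tcv _ Kz0.
pose F := convex_envelope g.
have FL x y : F x <= F y + 5 * M * `|x - y|.
  apply: (convex_envelope_lipschitz gz0) => {}x {}y.
  exact: (tangent_envelope_lipschitz M0 sM K0 norm_le_sup).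
have cF : convex_ineq F by exact: (convex_envelope_convex gz0).
have CF : C1 F.
  apply: (convex_smooth_C1 cF _ FL); apply: (convex_envelope_smooth gz0).
  exact: (tangent_envelope_smooth M0 sM sS K0).
have FK y : K y -> F y = f y.
  move=> Ky; have ty : tangent f G y y = f y.
    by rewrite /tangent subrr -(subrr y) innerBr subrr addr0.
  apply/le_anti/andP; split; last first.
    by rewrite -[leLHS]ty; exact: (convex_envelope_ge gz0 _ (tcv _ Ky)).
  apply: le_trans (convex_envelope_le gz0 _) _.
  apply: le_trans (tangent_envelope_le M0 sM K0 _ Ky) _.
  rewrite ty subrr normr0 gerDl.
  by have := profile_le_linear M0 sM (lexx 0); rewrite mulr0.
have FG y : K y -> gradient F y = G y.
  move=> Ky; apply: gradient_unique => [|x]; first exact: CF.1.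
  by rewrite FK//; exact: (convex_envelope_ge gz0 _ (tcv _ Ky)).
have lipF : (5 * M).-lipschitz F.
  move=> [x y] _ /=; rewrite ler_norml; apply/andP; split.
    by have := FL y x; rewrite distrC; lra.
  by have := FL x y; lra.
exists F; split.
- by split => //; exact/convex_functionP.
- apply: klipschitzW lipF.
  exact: (@globally_properfilter _ _ (z0, z0)).
- apply: ge_inf; first by exists 0 => k [].
  by split => //; rewrite mulr_ge0.
Qed.

End CompactJet.

(** By convexity all tangents support [F]; if the tangent at [y]
meets [F] at [x], it supports [F] there as well. *)
Lemma convex_C1_extension_necessary (R : realType) (X : hilbertType R)
    (K : set X) (f : X -> R) (G : X -> X) (F : X -> R) x y :
  convex_C1_extension K f G F -> K x -> K y ->
  tangent f G y x <= f x /\ (f x = tangent f G y x -> G x = G y).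
Proof.
move=> [/convex_functionP cF [dF _] Ff FG] Kx Ky.
have support w : tangent f G y w <= F w.
  by rewrite /tangent -Ff// -FG//; exact: convex_gradient_le.
split=> [|fxy]; first by rewrite -Ff.
rewrite -FG//; apply: gradient_unique => // w.
apply: le_trans (support w); rewrite Ff// fxy /tangent -addrA -innerDr.
by rewrite [x - y + _]addrC addrA subrK.
Qed.

Theorem theorem2 (R : realType) (X : hilbertType R) (K : set X)
    (f : X -> R) (G : X -> X) :
  K !=set0 -> compact K ->
  {within K, continuous f} -> {within K, continuous G} ->
  let cond_i := forall x y, K x -> K y -> f x >= f y + inner (G y) (x - y) in
  let cond_ii := forall x y, K x -> K y ->
    f x = f y + inner (G y) (x - y) -> G x = G y in
  ((exists F : X -> R, convex_C1_extension K f G F) <-> (cond_i /\ cond_ii))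
  /\
  (cond_i /\ cond_ii ->
    exists F : X -> R,
      [/\ convex_C1_extension K f G F,
          lipschitz F
        & Lip F <= 5 * sup [set `|G z| | z in K]]).
Proof.
move=> K0 cK cf cG cond_i cond_ii.
have ext : cond_i /\ cond_ii -> exists F : X -> R,
    [/\ convex_C1_extension K f G F, lipschitz F
      & Lip F <= 5 * sup [set `|G z| | z in K]].
  by case=> ci cii; exact: convex_C1_extension_exists.
split=> //; split=> [[F FE]|/ext[F [FE _ _]]]; last by exists F.
by split=> x y Kx Ky; have [] := convex_C1_extension_necessary FE Kx Ky.
Qed.
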